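(* Let $k\ge 3$ be an integer and let $X=\mathbb{B}_k$ be the $k$-book graph. Then the algebraic connectivity of the line graph $L(X)$ is $$a(L(X))=\frac{4+k-\sqrt{k^2+8}}{2}.$$
   Context: All graphs are finite and simple. The Laplacian matrix of a graph is its diagonal degree matrix minus its adjacency matrix; the algebraic connectivity $a(Y)$ of a graph $Y$ is the second smallest eigenvalue (counted with multiplicity) of its Laplacian matrix. $L(X)$ is the line graph of $X$. The $k$-book graph $\mathbb{B}_k$ is the Cartesian product $K_{1,k}\,\Box\,K_2$ of the star $K_{1,k}$ (with $k$ pendant vertices) and the complete graph $K_2$, where in $X_1\Box X_2$ the vertices $(x_1,x_2)$ and $(x_1',x_2')$ are adjacent iff either $x_1=x_1'$ and $x_2$ is adjacent to $x_2'$ in $X_2$, or $x_2=x_2'$ and $x_1$ is adjacent to $x_1'$ in $X_1$. *)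

(* Defs.v *)
From HB Require Import structures.
From mathcomp Require Import all_boot all_order all_algebra.
From mathcomp Require Import polyorder polyrcf.

Set Implicit Arguments.
Unset Strict Implicit.
Unset Printing Implicit Defensive.

Import Order.TTheory GRing.Theory Num.Theory.
Local Open Scope ring_scope.

Record sgraph := SGraph {
  vertex :> finType;
  adj : rel vertex;
  adj_sym : symmetric adj;
  adj_irrefl : irreflexive adj
}.

Definition edges (X : sgraph) : {set {set X}} :=
  [set [set u.1; u.2] | u : X * X & adj u.1 u.2].

Section LineGraph.
Variable X : sgraph.

Definition line_vertex := {e : {set X} | e \in edges X}.

Definition line_adj : rel line_vertex :=
  fun e f => (e != f) && (val e :&: val f != set0).

Fact line_adj_sym : symmetric line_adj.
Proof. by move=> e f; rewrite /line_adj eq_sym setIC. Qed.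

Fact line_adj_irrefl : irreflexive line_adj.
Proof. by move=> e; rewrite /line_adj eqxx. Qed.

Definition line_graph := SGraph line_adj_sym line_adj_irrefl.
End LineGraph.

Section CartesianProduct.
Variables X1 X2 : sgraph.

Definition box_adj : rel (X1 * X2)%type := fun x y =>
  ((x.1 == y.1) && adj x.2 y.2) || ((x.2 == y.2) && adj x.1 y.1).

Fact box_adj_sym : symmetric box_adj.
Proof.
move=> x y; rewrite /box_adj (eq_sym x.1) (eq_sym x.2) (adj_sym x.1).
by rewrite (adj_sym x.2).
Qed.

Fact box_adj_irrefl : irreflexive box_adj.
Proof. by move=> x; rewrite /box_adj !adj_irrefl !andbF. Qed.

Definition box := SGraph box_adj_sym box_adj_irrefl.
End CartesianProduct.

Section Complete.
Variable n : nat.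

Definition complete_adj : rel 'I_n := fun i j => i != j.

Fact complete_adj_sym : symmetric complete_adj.
Proof. by move=> i j; rewrite /complete_adj eq_sym. Qed.

Fact complete_adj_irrefl : irreflexive complete_adj.
Proof. by move=> i; rewrite /complete_adj eqxx. Qed.

Definition complete := SGraph complete_adj_sym complete_adj_irrefl.
End Complete.

(* The star K_{1,k}: the centre is None and the k leaves are the Some i. *)
Section Star.
Variable k : nat.

Definition star_adj : rel (option 'I_k) :=
  fun x y => (x == None) (+) (y == None).

Fact star_adj_sym : symmetric star_adj.
Proof. by move=> x y; rewrite /star_adj addbC. Qed.

Fact star_adj_irrefl : irreflexive star_adj.
Proof. by move=> x; rewrite /star_adj addbb. Qed.

Definition star := SGraph star_adj_sym star_adj_irrefl.
End Star.

Definition book k := box (star k) (complete 2).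

Section Spectrum.
Variable R : rcfType.

Definition degree (X : sgraph) (x : X) : nat := #|[set y | adj x y]|.

(* Matrices of X are indexed by 'I_#|X|, through the enumeration enum_val. *)
Definition degree_matrix (X : sgraph) : 'M[R]_#|X| :=
  diag_mx (\row_i (degree (enum_val i))%:R).

Definition adjacency_matrix (X : sgraph) : 'M[R]_#|X| :=
  \matrix_(i, j) (adj (enum_val i) (enum_val j))%:R.

Definition laplacian (X : sgraph) : 'M[R]_#|X| :=
  degree_matrix X - adjacency_matrix X.

(* rootsR lists the distinct roots in R in increasing order; repeating each of
   them according to its multiplicity yields the nondecreasing sequence of all
   the eigenvalues of A in R. For a symmetric A these are all its eigenvalues,
   so the sequence has length n. *)
Definition spectrum n (A : 'M[R]_n) : seq R :=
  flatten [seq nseq (\mu_x (char_poly A)) x | x <- rootsR (char_poly A)].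

(* Indices start at 0. The value is the junk 0 when X has fewer than two
   vertices. *)
Definition algebraic_connectivity (X : sgraph) : R :=
  (spectrum (laplacian X))`_1.
End Spectrum.

(* Main.v *)
(* An eigenvector of the Laplacian of the line graph of the book is a function f
   on the edges: a value s on the spine, x_(i,t) on the two page edges of the
   i-th page and p_i on its outer edge.  Comparing the eigenvalue equations at
   x_(i,0) and x_(i,1) gives x_(i,0) = x_(i,1) when l < 2, and then
   q(l) p_i = 2 (S + s) for all i, where S is the common value of the sums
   sum_i x_(i,t) and q(l) = (k + 2 - l) (2 - l) - 2.  The claimed value a < 2 is
   the smaller root of q.  For l < a all p_i are therefore equal, and what
   remains of the system only has constant solutions.  For l = a the vector with
   p = (1, -1, 0, ..., 0), x_(i,t) = (2 - a) / 2 * p_i and s = 0 is an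
   eigenvector.  So 0 and a are the two smallest roots of the characteristic
   polynomial.  That 0 is a simple root of it, and not only a geometrically
   simple eigenvalue, follows from Brauer's rank-one update L + J of the
   Laplacian by the all-ones matrix J: it is invertible, and
   X char(L + J) = char(L) (X - n). *)
Require Import Defs.
From mathcomp Require Import all_boot all_order all_algebra.
From mathcomp Require Import polyorder polyrcf ring lra.

Set Implicit Arguments.
Unset Strict Implicit.
Unset Printing Implicit Defensive.

Import Order.TTheory GRing.Theory Num.Theory.
Local Open Scope ring_scope.

(* Both sides are computed from the determinant of the bordered matrix
   [[X - A, v], [u, 1]]. *)
Lemma char_poly_rank_one_update (F : fieldType) n (A : 'M[F]_n) (a : F)
    (u : 'rV[F]_n) (v : 'cV[F]_n) :
  u *m A = a *: u ->
  ('X - a%:P) * char_poly (A + v *m u) =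
  char_poly A * ('X - a%:P - ((u *m v) ord0 ord0)%:P).
Proof.
move=> uA; pose U := map_mx polyC u; pose V := map_mx polyC v.
have U_char : U *m char_poly_mx A = ('X - a%:P) *: U.
  rewrite /char_poly_mx mulmxBr mul_mx_scalar -map_mxM uA map_mxZ.
  by rewrite scalerBl.
pose M := block_mx (char_poly_mx A) V U (1%:M : 'M_1).
have detM : \det M = char_poly (A + v *m u).
  suff -> : M = block_mx 1%:M V 0 1%:M *m
                block_mx (char_poly_mx (A + v *m u)) 0 U 1%:M.
    by rewrite det_mulmx det_ublock det_lblock !det1 !(mul1r, mulr1).
  rewrite mulmx_block !mul1mx !mulmx1 !mul0mx !add0r /M /char_poly_mx.
  by rewrite map_mxD map_mxM opprD addrA subrK.
rewrite -detM -(det_scalar1 ('X - a%:P)).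
(* The left factor has determinant ['X - a%:P]. It rescales the second block row and subtracts [U]
   times the first; by [U_char] this clears the lower left block. *)
transitivity (\det (block_mx (1%:M : 'M_n) 0 (- U) ('X - a%:P)%:M *m M)).
  by rewrite det_mulmx det_lblock det1 mul1r.
rewrite mulmx_block !mul1mx !mul0mx !addr0 mulNmx U_char mul_scalar_mx addNr.
rewrite mulmx1 mulNmx det_ublock; congr (_ * _).
rewrite [X in \det X]mx11_scalar det_scalar1 addrC -map_mxM !mxE /=.
by rewrite ?det_scalar1 ?eqxx ?mulr1n.
Qed.

(** * Eigenfunctions of a graph Laplacian and its two smallest eigenvalues *)

Section LaplacianSpectrum.
Variables (R : rcfType) (X : sgraph).
Implicit Types (f : X -> R) (l : R).

(** The eigenvalue equation vertex by vertex, free of the enumeration behind the matrix. The zero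
    function qualifies, so nonvanishing is stated separately. *)
Definition eigenfunction l f :=
  forall x, \sum_(y | adj x y) (f x - f y) = l * f x.

Definition row_of_fun f : 'rV[R]_#|X| := \row_i f (enum_val i).

Lemma row_of_fun_enum (v : 'rV[R]_#|X|) :
  row_of_fun (fun x => v ord0 (enum_rank x)) = v.
Proof. by apply/rowP=> i; rewrite !mxE enum_valK. Qed.

Lemma mul_row_of_fun_laplacian f :
  row_of_fun f *m laplacian R X =
  row_of_fun (fun x => \sum_(y | adj x y) (f x - f y)).
Proof.
apply/rowP=> j; rewrite /laplacian mulmxBr mxE mul_mx_diag !mxE.
rewrite sumrB; congr (_ - _).
  rewrite sumr_const mulr_natr; congr (_ *+ _).
  by apply: eq_card => y; rewrite !inE.
rewrite [RHS](reindex (@enum_val X xpredT)) /=; last first.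
  exact/onW_bij/enum_val_bij.
rewrite [RHS]big_mkcond; apply: eq_bigr => i _.
by rewrite !mxE adj_sym; case: (adj _ _); rewrite (mulr1, mulr0).
Qed.

Lemma eigenfunctionP l f :
  row_of_fun f *m laplacian R X = l *: row_of_fun f <-> eigenfunction l f.
Proof.
rewrite mul_row_of_fun_laplacian; split=> [/rowP E x | E].
  by have := E (enum_rank x); rewrite !mxE enum_rankK.
by apply/rowP=> i; rewrite !mxE E.
Qed.

Lemma root_char_poly_laplacianP l :
  reflect (exists2 f, eigenfunction l f & exists x, f x != 0)
          (root (char_poly (laplacian R X)) l).
Proof.
rewrite -eigenvalue_root_char; apply: (iffP eigenvalueP) => -[].
  move=> v vL /rV0Pn[i vi]; exists (fun x => v ord0 (enum_rank x)).
    by apply/eigenfunctionP; rewrite row_of_fun_enum.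
  by exists (enum_val i); rewrite enum_valK.
move=> f /eigenfunctionP fL [x fx]; exists (row_of_fun f) => //.
by apply/rV0Pn; exists (enum_rank x); rewrite mxE enum_rankK.
Qed.

Lemma laplacian_sym : (laplacian R X)^T = laplacian R X.
Proof.
rewrite /laplacian linearB /= tr_diag_mx; congr (_ - _).
by apply/matrixP=> i j; rewrite !mxE adj_sym.
Qed.

Lemma eigenfunction_cst (c : R) : eigenfunction 0 (fun=> c).
Proof. by move=> x; rewrite big1 ?mul0r // => y _; rewrite subrr. Qed.

Lemma multiplicity0_laplacian (x0 : X) :
    (forall f, eigenfunction 0 f -> forall x y, f x = f y) ->
  \mu_0 (char_poly (laplacian R X)) = 1%N.
Proof.
move=> ker_cst; set L := laplacian R X; pose u := row_of_fun (fun=> 1).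
have uL : u *m L = 0 *: u by apply/eigenfunctionP/eigenfunction_cst.
have Lu : L *m u^T = 0.
  by rewrite -[L]laplacian_sym -trmx_mul uL scale0r trmx0.
have uu : (u *m u^T) ord0 ord0 = #|X|%:R.
  rewrite mxE (eq_bigr (fun=> 1)) ?sumr_const ?card_ord // => i _.
  by rewrite !mxE mulr1.
have X_gt0 : #|X|%:R != 0 :> R.
  by rewrite pnatr_eq0 -lt0n; apply/card_gt0P; exists x0.
have := char_poly_rank_one_update u^T uL.
rewrite uu; set p := char_poly (L + _) => E.
(* If [v] is killed by [L + u^T *m u], multiplying by [u^T] gives [v *m u^T = 0]. So [v] lies in the
   kernel of [L], hence is constant, and its entries sum to 0. *)
have p0 : ~~ root p 0.
  rewrite -eigenvalue_root_char; apply/eigenvalueP=> -[v].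
  rewrite scale0r mulmxDr mulmxA => vE /eqP[].
  have vu : v *m u^T = 0.
    have /eqP := congr1 (mulmx^~ u^T) vE.
    rewrite /= mulmxDl mul0mx -(mulmxA v L) Lu mulmx0 add0r -!mulmxA.
    rewrite [u *m _]mx11_scalar uu -scalemx1 -!scalemxAr mulmx1 scaler_eq0.
    by rewrite (negPf X_gt0) => /eqP.
  move: vE; rewrite vu mul0mx addr0 -(row_of_fun_enum v).
  set f := (fun x => _) => vL; have /ker_cst f_cst : eigenfunction 0 f.
    by apply/eigenfunctionP; rewrite vL scale0r.
  apply/rowP=> i; rewrite !mxE (f_cst _ x0); apply/eqP.
  move/matrixP/(_ ord0 ord0)/eqP: vu; rewrite !mxE.
  rewrite (eq_bigr (fun=> f x0)) ?sumr_const ?card_ord => [|j _].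
    by rewrite -mulr_natr mulf_eq0 (negPf X_gt0) orbF.
  by rewrite !mxE mulr1 -(f_cst (enum_val j)) /f enum_valK.
have p_neq0 : p != 0 by apply: contraNneq p0 => ->; rewrite root0.
have Xp_neq0 : ('X - 0%:P) * p != 0 by rewrite mulf_neq0 ?polyXsubC_eq0.
have X_root : ~~ root ('X - 0%:P - #|X|%:R%:P) (0 : R).
  by rewrite /root !hornerE oppr0 sub0r oppr_eq0.
(* Of the four factors in [E], only ['X] and the characteristic polynomial of [L] can vanish at 0,
   so their multiplicities there agree. *)
have /(congr1 (multiplicity 0)) := E.
by rewrite !mu_mul -?E // mu_XsubC (muNroot p0) (muNroot X_root) !addn0.
Qed.

(** The distinct roots begin with 0 and [a]; as 0 is simple, index 1 of the spectrum is the first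
    copy of [a]. *)
Lemma algebraic_connectivity_eq (a : R) :
    0 < a ->
    (forall l f, l < a -> eigenfunction l f -> forall x y, f x = f y) ->
    (exists2 f, eigenfunction a f & exists x, f x != 0) ->
  algebraic_connectivity R X = a.
Proof.
move=> a_gt0 low_cst a_eigen.
have [f _ [x0 _]] := a_eigen.
have mu1 := multiplicity0_laplacian x0 (fun f => low_cst 0 f a_gt0).
rewrite /algebraic_connectivity /spectrum.
set p := char_poly _ in mu1 *.
have p_neq0 : p != 0 by rewrite monic_neq0 ?char_poly_monic.
have p0 : root p 0 by rewrite -mu_gt0 // mu1.
have pa : root p a by apply/root_char_poly_laplacianP.
(* A nonzero constant eigenfunction has eigenvalue 0. *)
have low0 l : root p l -> l < a -> l = 0.
  move=> /root_char_poly_laplacianP[g gl [x gx]] /low_cst-/(_ _ gl) g_cst.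
  have := gl x.
  rewrite big1 => [/esym/eqP|y _]; last by rewrite (g_cst y x) subrr.
  by rewrite mulf_eq0 (negPf gx) orbF => /eqP.
have mem_roots l : (l \in rootsR p) = root p l.
  by have /(_ l) := roots_on_rootsR p_neq0; rewrite !inE /=.
have : sorted <%R (rootsR p) by exact: sorted_roots.
have := mem_roots 0; have := mem_roots a; rewrite p0 pa.
case: (rootsR p) mem_roots => // r s mem_roots a_in z_in s_sorted.
have rp : root p r by rewrite -mem_roots mem_head.
have le_r l : l \in s -> r < l.
  by move=> ls; have /allP-/(_ l ls) := order_path_min lt_trans s_sorted.
have r0 : r = 0.
  apply: low0 => //; move: z_in; rewrite inE => /orP[/eqP <- // | /le_r].
  by move=> /lt_trans; apply.
case: s mem_roots a_in {z_in} s_sorted le_r => [|b s] mem_roots.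
  by rewrite r0 inE (gt_eqF a_gt0).
rewrite inE r0 (gt_eqF a_gt0) /= => a_in /andP[b_gt0 s_sorted] _.
have bp : root p b by rewrite -mem_roots !inE eqxx orbT.
have ba : b = a.
  move: a_in; rewrite inE => /orP[/eqP // | a_in].
  have /allP-/(_ a a_in) /= ltba := order_path_min lt_trans s_sorted.
  by have := low0 b bp ltba; move/eqP; rewrite gt_eqF.
rewrite mu1 -ba /=; have : (0 < \mu_b p)%N by rewrite mu_gt0.
by case: (\mu_b p).
Qed.

End LaplacianSpectrum.

(** * Vertices and adjacency of a line graph *)

Lemma set2_eq (T : finType) (x y z w : T) :
  ([set x; y] == [set z; w]) = (x == z) && (y == w) || (x == w) && (y == z).
Proof.
apply/eqP/orP=> [E | [/andP[/eqP-> /eqP->] | /andP[/eqP-> /eqP->]] //].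
  have: z \in [set x; y] by rewrite E set21.
  have: w \in [set x; y] by rewrite E set22.
  have: x \in [set z; w] by rewrite -E set21.
  have: y \in [set z; w] by rewrite -E set22.
  rewrite !inE => /orP[]/eqP-> /orP[]/eqP->; rewrite ?eqxx ?orbb /=; auto.
  - by rewrite eq_sym => ->; left.
  - by move=> _; rewrite eq_sym => ->; right.
by rewrite setUC.
Qed.

Section LineGraphVertices.
Variable X : sgraph.

Lemma set2_edges (x y : X) : adj x y -> [set x; y] \in edges X.
Proof. by move=> xy; apply/imsetP; exists (x, y); rewrite ?inE. Qed.

Definition edge (x y : X) (xy : adj x y) : line_graph X :=
  exist _ [set x; y] (set2_edges xy).

Lemma edge_eq (x y z w : X) (xy : adj x y) (zw : adj z w) :
  (edge xy == edge zw) = (x == z) && (y == w) || (x == w) && (y == z).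
Proof. by rewrite -val_eqE /= set2_eq. Qed.

Lemma adj_edge (x y z w : X) (xy : adj x y) (zw : adj z w) :
  adj (edge xy) (edge zw) =
  (edge xy != edge zw) && [|| x == z, x == w, y == z | y == w].
Proof.
rewrite /= /line_adj; congr (_ && _); apply/set0Pn/idP => /= [[v] | H].
  rewrite !inE => /andP[/orP[]/eqP-> /orP[]->]; rewrite ?orbT //.
case/or4P: H => /eqP E; [exists x | exists x | exists y | exists y];
  by rewrite !inE E eqxx ?orbT.
Qed.

Lemma edgeP (e : line_graph X) : exists x y (xy : adj x y), e = edge xy.
Proof.
have /imsetP[[x y] xy e_xy] := valP e; rewrite inE in xy.
by exists x, y, xy; apply/val_inj.
Qed.

End LineGraphVertices.

(** * The edges of the book and their incidences *)

Lemma sum_ord2 (V : nmodType) (F : 'I_2 -> V) :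
  \sum_t F t = F ord0 + F ord_max.
Proof.
by rewrite !big_ord_recl big_ord0 addr0; congr (_ + F _); apply/val_inj.
Qed.

Section BookEdges.
Variable k : nat.
Implicit Types (i j : 'I_k) (t : 'I_2).

Fact spine_adj : @adj (book k) (None, ord0) (None, ord_max).
Proof. by []. Qed.

Fact page_adj i t : @adj (book k) (None, t) (Some i, t).
Proof. by rewrite /= /box_adj eqxx. Qed.

Fact rung_adj i : @adj (book k) (Some i, ord0) (Some i, ord_max).
Proof. by rewrite /= /box_adj eqxx. Qed.

Definition spine := edge spine_adj.
Definition page i t := edge (page_adj i t).
Definition rung i := edge (rung_adj i).

Lemma book_edge_ind (P : line_graph (book k) -> Prop) :
  P spine -> (forall i t, P (page i t)) -> (forall i, P (rung i)) ->
  forall e, P e.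
Proof.
move=> Ps Pp Pr e; have [x [y [xy ->]]] := edgeP e.
have ord2 t : t = ord0 \/ t = ord_max.
  by case: t => -[|[|//]] lt_t; [left | right]; apply/val_inj.
(* Edges are unordered, so the endpoints may match those of the chosen representative in either
   order. *)
have edgeE (z w : book k) (zw : adj z w) :
    (x == z) && (y == w) || (x == w) && (y == z) -> P (edge zw) -> P (edge xy).
  by rewrite -(edge_eq xy zw) => /eqP ->.
case: x y xy edgeE => [x t] [y u] /= xy edgeE; have := xy.
rewrite /box_adj /= => /orP[/andP[/eqP Exy tu] | /andP[/eqP Etu]].
  case: x Exy xy edgeE => [i|] <- xy edgeE.
    apply: edgeE (Pr i); rewrite !xpair_eqE !eqxx /=; move: tu.
    by case: (ord2 t) => ->; case: (ord2 u) => ->.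
  apply: edgeE Ps; move: tu.
  by case: (ord2 t) => ->; case: (ord2 u) => ->.
case: x y xy edgeE => [i|] [j|] // xy edgeE _.
  by apply: edgeE (Pp i t); rewrite Etu !xpair_eqE !eqxx.
by apply: edgeE (Pp j t); rewrite Etu !xpair_eqE !eqxx.
Qed.

(** A bijection from a sum type, used to split sums over all edges by kind; [book_edge_ind] provides
    its surjectivity. *)
Definition edge_of_code (c : unit + ('I_k * 'I_2 + 'I_k)) :
    line_graph (book k) :=
  match c with
  | inl _ => spine
  | inr (inl it) => page it.1 it.2
  | inr (inr i) => rung i
  end.

Lemma page_eq i t j u : (page i t == page j u) = (i == j) && (t == u).
Proof.
rewrite edge_eq !xpair_eqE !eqxx /= ?andbF ?orbF.
have -> : (Some i == Some j) = (i == j) by [].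
by case: (t == u); rewrite ?andbT ?andbF.
Qed.

Lemma rung_eq i j : (rung i == rung j) = (i == j).
Proof.
by rewrite edge_eq !xpair_eqE !eqxx /= ?andbT ?andbF ?orbF andbb.
Qed.

Lemma spine_page i t : (spine == page i t) = false.
Proof. by rewrite edge_eq !xpair_eqE /= ?andbF. Qed.

Lemma spine_rung i : (spine == rung i) = false.
Proof. by rewrite edge_eq. Qed.

Lemma page_rung i t j : (page i t == rung j) = false.
Proof. by rewrite edge_eq. Qed.

Lemma edge_of_code_inj : injective edge_of_code.
Proof.
move=> [[]|[[i t]|i]] [[]|[[j u]|j]] //= /eqP.
all: rewrite ?(eq_sym _ spine) ?(eq_sym (rung _) (page _ _)).
all: rewrite ?spine_page ?spine_rung ?page_rung ?page_eq ?rung_eq //.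
  by case/andP=> /eqP-> /eqP->.
by move/eqP->.
Qed.

Lemma big_book_edges (V : nmodType) (F : line_graph (book k) -> V) :
  \sum_e F e = F spine + (\sum_i \sum_t F (page i t) + \sum_i F (rung i)).
Proof.
transitivity (\sum_(e in [set edge_of_code c | c in predT]) F e).
  apply: eq_bigl => e; apply/esym/imsetP.
  elim/book_edge_ind: e => [|i t|i].
  - by exists (inl tt).
  - by exists (inr (inl (i, t))).
  - by exists (inr (inr i)).
rewrite big_imset /=; last by move=> c d _ _ /edge_of_code_inj.
rewrite big_sumType /= big_sumType /=; congr (_ + (_ + _)).
  by rewrite (big_pred1 tt) //; case.
by rewrite pair_big.
Qed.

Lemma adj_spine_page i t : adj spine (page i t).
Proof.
rewrite adj_edge spine_page !xpair_eqE /=.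
by case: t => -[|[|//]].
Qed.

Lemma adj_spine_rung i : adj spine (rung i) = false.
Proof. by rewrite adj_edge !xpair_eqE andbF. Qed.

(** Page edges on the same side [t] meet at the centre [(None, t)] and form a clique; those on
    opposite sides are disjoint. *)
Lemma adj_page i t j u : adj (page i t) (page j u) = (t == u) && (i != j).
Proof.
rewrite adj_edge page_eq !xpair_eqE /=.
have -> : (Some i == Some j) = (i == j) by [].
by do 2 case: eqP.
Qed.

Lemma adj_page_rung i t j : adj (page i t) (rung j) = (i == j).
Proof.
rewrite adj_edge page_rung !xpair_eqE /=.
have -> : (Some i == Some j) = (i == j) by [].
by case: eqP => //= _; case: t => -[|[|//]].
Qed.

Lemma adj_rung i j : adj (rung i) (rung j) = false.
Proof.
rewrite adj_edge rung_eq !xpair_eqE /= ?andbF ?andbT /=.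
have -> : (Some i == Some j) = (i == j) by [].
by case: eqP.
Qed.

(** * The Laplacian at each kind of edge *)

Section BookEigenfunctions.
Variables (R : rcfType) (f : line_graph (book k) -> R).

Lemma sum_adj_spine :
  \sum_(e | adj spine e) (f spine - f e) =
  \sum_i \sum_t (f spine - f (page i t)).
Proof.
rewrite big_mkcond big_book_edges adj_irrefl add0r.
rewrite [X in _ + X]big1 ?addr0 => [|i _]; last by rewrite adj_spine_rung.
by apply: eq_bigr => i _; apply: eq_bigr => t _; rewrite adj_spine_page.
Qed.

(** The clique sum may include [j = i], whose term is zero; summing over all [j] lets
    [sum_sub_const] apply. *)
Lemma sum_adj_page i t :
  \sum_(e | adj (page i t) e) (f (page i t) - f e) =
  f (page i t) - f spine + (f (page i t) - f (rung i)) +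
  \sum_j (f (page i t) - f (page j t)).
Proof.
rewrite big_mkcond big_book_edges adj_sym adj_spine_page.
rewrite -[RHS]addrA; congr (_ + _).
rewrite [LHS]addrC; congr (_ + _).
  rewrite -big_mkcond (big_pred1 i) // => j.
  by rewrite adj_page_rung eq_sym.
apply: eq_bigr => j _; rewrite -big_mkcond /= (eq_bigl _ _ (adj_page i t j)).
have [-> | ij] := eqVneq i j.
  by rewrite subrr big_pred0 // => u; rewrite andbF.
by rewrite (big_pred1 t) // => u; rewrite andbT eq_sym.
Qed.

Lemma sum_adj_rung i :
  \sum_(e | adj (rung i) e) (f (rung i) - f e) =
  \sum_t (f (rung i) - f (page i t)).
Proof.
rewrite big_mkcond big_book_edges adj_sym adj_spine_rung add0r.
rewrite [X in _ + X]big1 ?addr0 => [|j _]; last by rewrite adj_rung.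
rewrite -[RHS](big_pred1_eq +%R i
  (fun j => \sum_t (f (rung i) - f (page j t)))).
rewrite [RHS]big_mkcond; apply: eq_bigr => j _.
under eq_bigr => t _ do rewrite adj_sym adj_page_rung.
by rewrite /=; case: eqP => // _; rewrite big1.
Qed.

End BookEigenfunctions.
End BookEdges.

Lemma sum_sub_const (R : rcfType) k (c : R) (g : 'I_k -> R) :
  \sum_i (c - g i) = k%:R * c - \sum_i g i.
Proof. by rewrite sumrB sumr_const card_ord mulr_natl. Qed.

(** * The smaller root of the quadratic *)

Definition book_root (R : rcfType) (k : nat) : R :=
  (4%:R + k%:R - Num.sqrt (k%:R ^+ 2 + 8%:R)) / 2%:R.

Section BookRoot.
Variables (R : rcfType) (k : nat).
Local Notation K := (k%:R : R).
Local Notation a := (book_root R k).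
Local Notation s := (Num.sqrt (K ^+ 2 + 8%:R)).

Lemma sqr_sqrt_book : s ^+ 2 = K ^+ 2 + 8%:R.
Proof. by rewrite sqr_sqrtr // addr_ge0 ?sqr_ge0. Qed.

Lemma book_root_gt0 : 0 < a.
Proof.
have K_ge0 : 0 <= K by [].
have s_ge0 : 0 <= s by apply: sqrtr_ge0.
have := sqr_sqrt_book; rewrite /book_root.
move: s s_ge0 K_ge0 => u u_ge0 K_ge0 E.
have : u < 4 + K by rewrite -(ltr_pXn2r (ltn0Sn 1)) ?nnegrE ?E; nra.
by lra.
Qed.

Lemma book_root_lt2 : a < 2.
Proof.
have K_ge0 : 0 <= K by [].
have s_ge0 : 0 <= s by apply: sqrtr_ge0.
have := sqr_sqrt_book; rewrite /book_root.
move: s s_ge0 K_ge0 => u u_ge0 K_ge0 E.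
have : K < u by rewrite -(ltr_pXn2r (ltn0Sn 1)) ?nnegrE ?E; nra.
by lra.
Qed.

(** With [u] the square root, the factors are [(u + K) / 2] and [(u - K) / 2]. *)
Lemma book_rootE : (K + 2 - a) * (2 - a) = 2.
Proof.
have := sqr_sqrt_book; rewrite /book_root; move: s => u E.
transitivity ((u ^+ 2 - K ^+ 2) / 4); first by field.
by rewrite E; field.
Qed.

(** Both factors are positive at [a] and grow as [l] decreases. *)
Lemma lt_book_root l : l < a -> 2 < (K + 2 - l) * (2 - l).
Proof.
have K_ge0 : 0 <= K by [].
have := book_root_lt2; have := book_rootE; move: a => b; nra.
Qed.

End BookRoot.

(** * Eigenfunctions below and at the root *)

Lemma book_low_eigenfunction (R : rcfType) k l
    (f : line_graph (book k) -> R) :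
  (0 < k)%N -> l < book_root R k -> eigenfunction l f ->
  forall e1 e2, f e1 = f e2.
Proof.
move=> k_gt0 l_lt f_eig.
have K_ge1 : 1 <= k%:R :> R by rewrite ler1n.
have l_lt2 : l < 2 := lt_trans l_lt (book_root_lt2 R k).
have q_gt := lt_book_root l_lt.
pose s := f (spine k); pose x i t := f (page i t); pose p i := f (rung i).
pose S t := \sum_i x i t.
have Hs : 2 * k%:R * s - (S ord0 + S ord_max) = l * s.
  rewrite -f_eig sum_adj_spine exchange_big sum_ord2 !sum_sub_const -/s.
  by rewrite /S /x; ring.
have Hx i t : x i t - s + (x i t - p i) + (k%:R * x i t - S t) = l * x i t.
  by rewrite -f_eig sum_adj_page sum_sub_const.
have Hp i : p i - x i ord0 + (p i - x i ord_max) = l * p i.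
  by rewrite -f_eig sum_adj_rung sum_ord2.
have HS t : 2 * S t - k%:R * s - \sum_i p i = l * S t.
  rewrite [RHS]mulr_sumr -(eq_bigr _ (fun i _ => Hx i t)).
  rewrite !big_split /= !sumrN -mulr_sumr !sumr_const card_ord.
  by rewrite -[s *+ k]mulr_natl -[S t *+ k]mulr_natl -/(S t); ring.
(* Subtracting the two instances of [HS] cancels [s] and the sum of the [p i]. *)
have S01 : S ord0 = S ord_max.
  have : (2 - l) * (S ord0 - S ord_max) = 0.
    by have := HS ord0; have := HS ord_max; lra.
  by move/eqP; rewrite mulf_eq0 !subr_eq0 (gt_eqF l_lt2) => /eqP.
have x01 i : x i ord0 = x i ord_max.
  have : (k%:R + 2 - l) * (x i ord0 - x i ord_max) = 0.
    have := Hx i ord0; have := Hx i ord_max; rewrite S01; lra.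
  move/eqP; rewrite mulf_eq0 !subr_eq0 => /orP[|/eqP //].
  by rewrite gt_eqF //; lra.
pose q := (k%:R + 2 - l) * (2 - l) - 2.
pose c := 2 * (S ord0 + s) / q.
have q_neq0 : q != 0 by rewrite gt_eqF // /q; lra.
(* The rung equation expresses [x i ord0] as [(2 - l) / 2 * p i]; the page equation then involves
   only [p i], [S ord0] and [s]. *)
have pE i : p i = c.
  apply/(mulIf q_neq0); rewrite /c divfK //.
  have := Hx i ord0; have := Hp i; rewrite -x01 /q; nra.
have xE i t : x i t = (2 - l) / 2 * c.
  suff -> : x i t = x i ord0 by have := Hp i; rewrite -x01 pE; lra.
  case: t => -[|[|//]] lt_t; [|rewrite x01]; by congr (x i _); apply/val_inj.
have SE : S ord0 = k%:R * ((2 - l) / 2 * c).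
  rewrite /S (eq_bigr _ (fun i _ => xE i ord0)).
  by rewrite sumr_const card_ord mulr_natl.
(* The page equation solved for [s]; the terms in [k] cancel. *)
have sE : s = ((2 - l) ^+ 2 / 2 - 1) * c.
  by have := Hx (Ordinal k_gt0) ord0; rewrite xE pE SE; nra.
have lc : l * c = 0.
  (* [l] times the last factor is the characteristic polynomial of the 3 x 3
     quotient matrix acting on the triples (s, x, p). *)
  have : (l * c) * ((k%:R + 2 - l) ^+ 2 - (k%:R ^+ 2 - 2 * k%:R + 2)) = 0.
    by move: Hs; rewrite -S01 SE sE; nra.
  move/eqP; rewrite mulf_eq0 => /orP[/eqP // |].
  (* The square exceeds [k%:R ^+ 2] because [l < 2], and the subtracted term is at most [k%:R ^+ 2]
     because [1 <= k%:R]. *)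
  by rewrite gt_eqF //; nra.
(* Each value of [f] is [c] times a polynomial in [l] with constant term 1, so [l * c = 0] reduces
   it to [c]. *)
suff fE e : f e = c by move=> e1 e2; rewrite !fE.
elim/book_edge_ind: e => [|i t|i]; last exact: pE.
  rewrite -/s sE; transitivity (c + (l / 2 - 2) * (l * c)); first by field.
  by rewrite lc mulr0 addr0.
rewrite -/(x i t) xE; transitivity (c - (l * c) / 2); first by field.
by rewrite lc mul0r subr0.
Qed.

(** Functions on the edges are defined by inverting [edge_of_code] with [pick]; the default 0 is
    never reached, since every edge has a code. *)
Lemma book_fun (R : rcfType) k (s : R) (x : 'I_k -> 'I_2 -> R) (p : 'I_k -> R) :
  exists f : line_graph (book k) -> R,
  [/\ f (spine k) = s, forall i t, f (page i t) = x i t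
    & forall i, f (rung i) = p i].
Proof.
pose h (c : unit + ('I_k * 'I_2 + 'I_k)) :=
  match c with
  | inl _ => s
  | inr (inl it) => x it.1 it.2
  | inr (inr i) => p i
  end.
pose f (e : line_graph (book k)) := oapp h 0 [pick c | edge_of_code c == e].
have fE c : f (edge_of_code c) = h c.
  rewrite /f; case: pickP => [d /eqP/edge_of_code_inj -> // | /(_ c)].
  by rewrite eqxx.
exists f; split=> [|i t|i].
- exact: fE (inl tt).
- exact: fE (inr (inl (i, t))).
- exact: fE (inr (inr i)).
Qed.

Lemma book_root_eigenfunction (R : rcfType) k :
  (1 < k)%N ->
  exists2 f : line_graph (book k) -> R,
    eigenfunction (book_root R k) f & exists e, f e != 0.
Proof.
move=> k_gt1; set a := book_root R k.
pose i0 : 'I_k := Ordinal (ltnW k_gt1); pose i1 : 'I_k := Ordinal k_gt1.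
pose d i : R := (i == i0)%:R - (i == i1)%:R.
have sum_delta j : \sum_i (i == j :> 'I_k)%:R = 1 :> R.
  by rewrite (bigD1 j) //= eqxx big1 ?addr0 // => i /negPf ->.
have sum_d : \sum_i d i = 0 by rewrite sumrB !sum_delta subrr.
(* The ratio of page to rung values forced by the rung equation. With [s] and the page sums zero,
   the page equation becomes [aE]. *)
pose b := (2 - a) / 2.
have aE : (k%:R + 2 - a) * b = 1.
  by rewrite /b mulrA book_rootE divff ?pnatr_eq0.
have [f [fs fx fp]] := book_fun 0 (fun i _ => b * d i) d.
exists f; last by exists (rung i0); rewrite fp /d eqxx subr0 oner_eq0.
elim/book_edge_ind=> [|i t|i].
- rewrite sum_adj_spine fs mulr0 exchange_big big1 // => t _.
  rewrite (eq_bigr _ (fun i _ => congr1 (fun y => 0 - y) (fx i t))).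
  by rewrite sum_sub_const -mulr_sumr sum_d !mulr0 subr0.
- rewrite sum_adj_page fs fx fp.
  rewrite (eq_bigr _ (fun j _ => congr1 (fun y => b * d i - y) (fx j t))).
  rewrite sum_sub_const -mulr_sumr sum_d mulr0.
  transitivity (((k%:R + 2 - a) * b - 1) * d i + a * (b * d i)); first by ring.
  by rewrite aE subrr mul0r add0r.
by rewrite sum_adj_rung sum_ord2 !fx fp /b; field.
Qed.

Theorem theorem16 (R : rcfType) (k : nat) (hk : (3 <= k)%N) :
  algebraic_connectivity R (line_graph (book k)) =
    (4%:R + k%:R - Num.sqrt (k%:R ^+ 2 + 8%:R)) / 2%:R.
Proof.
apply: algebraic_connectivity_eq (book_root_gt0 R k) _ _.
  by move=> l f; apply: book_low_eigenfunction; apply: leq_trans hk.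
by apply: book_root_eigenfunction; apply: leq_trans hk.
Qed.
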